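(* Let $K$ be the two-element field and $X = (K^3)^{\mathbb{Z}}$, identified with $(K^{\mathbb{Z}})^3$, with the cellwise vector space operations. For each integer $i \geq 0$ define $[\cdot,\cdot]_i : X \times X \to X$ by $$[(x,y,w),(x',y',w')]_i = \Bigl(0^{\mathbb{Z}},\, 0^{\mathbb{Z}},\, \sum_{n \in \mathbb{Z}} (x_n y'_n - x'_n y_n)\, \chi_{\{n,\, n+i\}}\Bigr).$$ Then each $[\cdot,\cdot]_i$ is a Lie bracket compatible with the vector shift structure of $X$, and for all $0 \leq i < j$ the Lie algebraic subshifts $(X, [\cdot,\cdot]_i)$ and $(X, [\cdot,\cdot]_j)$ are not isomorphic. In fact, even ignoring the vector space structure, the algebras $(X,[\cdot,\cdot]_i,0)$ and $(X,[\cdot,\cdot]_j,0)$, where only the bracket and the zero element are considered as structure, are not isomorphic in the category of subshifts: there is no shift-commuting homeomorphism $\phi : X \to X$ with $\phi(0) = 0$ and $\phi([u,v]_i) = [\phi(u),\phi(v)]_j$ for all $u,v \in X$.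
   Context: $X$ carries the product topology and the shift action of $\mathbb{Z}$, $(g x)_h = x_{h-g}$. For $B \subset \mathbb{Z}$, $\chi_B \in K^{\mathbb{Z}}$ is the characteristic function of $B$ (so for $i=0$, $\chi_{\{n,n+i\}} = \chi_{\{n\}}$). The infinite sum is taken cellwise in $K^{\mathbb{Z}}$ (only finitely many terms are nonzero at each coordinate). A Lie bracket on $X$ is compatible with the vector shift structure if it is continuous, commutes with the shift, and makes $X$ with its cellwise vector space operations a Lie algebra over $K$. An isomorphism of Lie algebraic subshifts is a shift-commuting homeomorphism that is an isomorphism of Lie algebras. *)

(* Defs.v *)
From HB Require Import structures.
From mathcomp Require Import all_boot all_order all_algebra.
From mathcomp Require Import all_classical all_reals all_analysis.

Set Implicit Arguments.
Unset Strict Implicit.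
Unset Printing Implicit Defensive.

(* Puts the product topology on function types, in particular on [int -> A]. *)
Export ArrowAsProduct.

Import GRing.Theory.
Local Open Scope classical_set_scope.
Local Open Scope ring_scope.

(* The two-element field with the discrete topology; this is an alias because
   ['F_2] unfolds to an ordinal type, on which no topology should be declared.
   The module structure is that of [K] over itself. *)
Definition K : Type := 'F_2.
HB.instance Definition _ := Finite.on K.
HB.instance Definition _ := GRing.Field.on K.
HB.instance Definition _ := GRing.Lmodule.copy K K^o.
HB.instance Definition _ := isPointed.Build K (0 : 'F_2).
HB.instance Definition _ := hasNbhs.Build K principal_filter.
HB.instance Definition _ := Discrete_ofNbhs.Build K erefl.
HB.instance Definition _ := DiscreteUniform_ofNbhs.Build K.

Definition shift_act (A : Type) (g : int) (x : int -> A) : int -> A :=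
  fun h => x (h - g).

Definition shift_commuting (A B : Type) (phi : (int -> A) -> (int -> B)) : Prop :=
  forall (g : int) (x : int -> A), phi (shift_act g x) = shift_act g (phi x).

Definition homeomorphism (S T : topologicalType) (phi : S -> T) : Prop :=
  continuous phi /\
  exists psi : T -> S, [/\ cancel phi psi, cancel psi phi & continuous psi].

(* Over a field of characteristic 2, [v, v] = 0 is strictly stronger than
   antisymmetry. *)
Record lie_bracket (F : fieldType) (V : lmodType F) (br : V -> V -> V) : Prop := {
  lie_bilinear : bilinear_for *:%R *:%R br;
  lie_alternating : forall u, br u u = 0;
  lie_jacobi : forall u v w,
    br u (br v w) + br v (br w u) + br w (br u v) = 0
}.

Notation X := (int -> K * K * K)%type.

Record compatible_lie_bracket (br : X -> X -> X) : Prop := {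
  compatible_continuous : continuous (fun p : X * X => br p.1 p.2);
  compatible_shift : forall (g : int) (u v : X),
    br (shift_act g u) (shift_act g v) = shift_act g (br u v);
  compatible_lie : lie_bracket br
}.

Definition lie_subshift_isomorphism
    (br br' : X -> X -> X) (phi : X -> X) : Prop :=
  [/\ homeomorphism phi, shift_commuting phi, linear phi &
      forall u v, phi (br u v) = br' (phi u) (phi v)].

(* Isomorphism for the structure consisting of the bracket and 0 only. *)
Definition pointed_bracket_isomorphism
    (br br' : X -> X -> X) (phi : X -> X) : Prop :=
  [/\ homeomorphism phi, shift_commuting phi, phi 0 = 0 &
      forall u v, phi (br u v) = br' (phi u) (phi v)].

(* The sum over [n] has finite support at each coordinate [h]. *)
Definition bracket (i : nat) (u v : X) : X := fun h : int =>
  (0, 0,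
   \sum_(n \in [set: int])
     ((u n).1.1 * (v n).1.2 - (v n).1.1 * (u n).1.2)
       * \1_[set n; n + i%:Z] h).

(* Main.v *)
Require Import Defs.
From mathcomp Require Import all_boot all_order all_algebra.
From mathcomp Require Import all_classical all_reals all_analysis.
From mathcomp Require Import ring zify.

(** The bracket depends only on the sequence c(n) = x(n) y'(n) - x'(n) y(n): its
    third component is (1 + s^i) c if 0 < i and c if i = 0, with s the shift.
    An isomorphism preserves the points of period j.  On these 1 + s^j is 2 = 0,
    so the j-th bracket vanishes there, whereas for i < j the i-th bracket does
    not: take both x and y' to be the characteristic function of jZ. *)

Import GRing.Theory.
Local Open Scope classical_set_scope.
Local Open Scope ring_scope.

Definition cross (u v : X) (n : int) : K :=
  (u n).1.1 * (v n).1.2 - (v n).1.1 * (u n).1.2.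

(** At coordinate [h] only the indices [h] and [h - i] contribute to the sum. For [i = 0] they
    coincide and count once, whence the case distinction. *)
Lemma bracketE (i : nat) (u v : X) (h : int) :
  bracket i u v h =
  (0, 0, cross u v h + if i == 0%N then 0 else cross u v (h - i%:Z)).
Proof.
rewrite /bracket; congr pair.
rewrite (fsbigE (undup [:: h; h - i%:Z])) ?undup_uniq //; last first.
  move=> n _; rewrite mem_undup !inE negb_or => /andP[nh nhi].
  rewrite indicE memNset ?mulr0 // => -[/esym/eqP|hE]; first exact/negP.
  by case/eqP: nhi; rewrite hE addrK.
have cover n : (n == h) || (n == h - i%:Z) -> \1_[set n; n + i%:Z] h = 1 :> K.
  move=> nE; rewrite indicE mem_set //.
  by case/orP: nE => /eqP->; [left | right; rewrite subrK].
rewrite /= inE; case: i cover => [|i] cover.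
  by rewrite subr0 eqxx big_cons big_nil cover ?eqxx // mulr1 in_setT.
rewrite ifN; last first.
  by apply/eqP => /esym/eqP; rewrite -subr_eq0; lia.
by rewrite !big_cons big_nil !in_setT addr0 !cover ?eqxx ?orbT // !mulr1.
Qed.

Lemma K_addrr (a : K) : a + a = 0.
Proof. by case: a => [[|[|//]] ?]; apply/val_inj. Qed.

Lemma cross_shift (g : int) (u v : X) (n : int) :
  cross (shift_act g u) (shift_act g v) n = cross u v (n - g).
Proof. by []. Qed.

Lemma cross_linearl (a : K) (u u' v : X) (n : int) :
  cross (a *: u + u') v n = a * cross u v n + cross u' v n.
Proof.
rewrite /cross.
have -> : ((a *: u + u') n).1.1 = a * (u n).1.1 + (u' n).1.1 by [].
have -> : ((a *: u + u') n).1.2 = a * (u n).1.2 + (u' n).1.2 by [].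
by ring.
Qed.

Lemma cross_linearr (a : K) (u v v' : X) (n : int) :
  cross u (a *: v + v') n = a * cross u v n + cross u v' n.
Proof.
rewrite /cross.
have -> : ((a *: v + v') n).1.1 = a * (v n).1.1 + (v' n).1.1 by [].
have -> : ((a *: v + v') n).1.2 = a * (v n).1.2 + (v' n).1.2 by [].
by ring.
Qed.

Lemma cross_alternating (u : X) (n : int) : cross u u n = 0.
Proof. by rewrite /cross subrr. Qed.

Lemma bracket_bilinear (i : nat) : bilinear_for *:%R *:%R (bracket i).
Proof.
(* Used from right to left, with [d] and [e] standing for the conditional terms of [bracketE];
   whether [i] is 0 then matters only at the very end. *)
have lin (a b c d e : K) :
    (0, 0, (a * b + c) + (a * d + e)) = a *: (0, 0, b + d) + (0, 0, c + e) :> K * K * K.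
  apply/pair_equal_spec; split.
    by apply/pair_equal_spec; split; rewrite /= scaler0 addr0.
  by rewrite -[RHS]/(a * (b + d) + (c + e)); ring.
split=> w a u v; apply/funext => h.
  rewrite -[RHS]/(a *: (bracket i u w h) + bracket i v w h) !bracketE.
  rewrite !cross_linearl -lin; by case: (i == _); rewrite ?mulr0 ?addr0.
rewrite -[RHS]/(a *: (bracket i w u h) + bracket i w v h) !bracketE.
rewrite !cross_linearr -lin; by case: (i == _); rewrite ?mulr0 ?addr0.
Qed.

(** [cross] does not see the third component, so points supported there are central. *)
Lemma bracket_center (i : nat) (u z : X) :
  (forall n, (z n).1 = 0) -> bracket i u z = 0.
Proof.
move=> z0; apply/funext => h; rewrite bracketE.
have c0 n : cross u z n = 0 by rewrite /cross z0 mulr0 mul0r subrr.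
by rewrite !c0 if_same addr0.
Qed.

Lemma bracket_lie (i : nat) : lie_bracket (bracket i).
Proof.
split; first exact: bracket_bilinear.
  move=> u; apply/funext => h; rewrite bracketE !cross_alternating.
  by rewrite if_same addr0.
(* All brackets are central, so the algebra is nilpotent of class at most 2 and the Jacobi sum
   vanishes term by term. *)
have nil2 u v w : bracket i u (bracket i v w) = 0.
  by apply: bracket_center => n; rewrite bracketE.
by move=> u v w; rewrite !nil2 !addr0.
Qed.

Lemma bracket_shift (i : nat) (g : int) (u v : X) :
  bracket i (shift_act g u) (shift_act g v) = shift_act g (bracket i u v).
Proof.
apply/funext => h; rewrite [RHS]/shift_act !bracketE !cross_shift.
by rewrite [h - i%:Z - g]addrAC.
Qed.

Lemma nbhs_prod_set1 (S T : topologicalType) (a : S) (b : T) :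
  nbhs a [set a] -> nbhs b [set b] -> nbhs (a, b) [set (a, b)].
Proof.
move=> na nb; exists ([set a], [set b]) => //=.
by case=> x y /= [-> ->].
Qed.

(** Coordinate projections are continuous and the alphabet is discrete. *)
Lemma coordinate_locally_constant (n : int) (u : X) :
  \forall u' \near u, u' n = u n.
Proof.
have coord : continuous (fun u' : X => u' n).
  exact: (@proj_continuous int (fun=> (K * K * K)%type) n).
suff /coord : nbhs (u n) [set u n] by [].
have nK (a : K) : nbhs a [set a] by rewrite nbhs_principalE.
by case: (u n) => [[a b] c]; do !apply: nbhs_prod_set1.
Qed.

Lemma bracket_continuous (i : nat) :
  continuous (fun p : X * X => bracket i p.1 p.2).
Proof.
move=> p.
have near_p n : \forall q \near p, q.1 n = p.1 n /\ q.2 n = p.2 n.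
  exists ([set u | u n = p.1 n], [set v | v n = p.2 n]) => //=.
  by split; exact: coordinate_locally_constant.
(* The product topology is a supremum over coordinates, so each [h] is treated alone; there the
   bracket reads its arguments only at [h] and [h - i]. *)
apply/cvg_sup => h U [_ [[W _ <-] Wp] WU].
apply: filterS2 (near_p h) (near_p (h - i%:Z)) => q [qh1 qh2] [qi1 qi2].
apply: WU; rewrite /preimage /= in Wp *.
by move: Wp; rewrite !bracketE /cross qh1 qh2 qi1 qi2.
Qed.

Lemma bracket_compatible (i : nat) : compatible_lie_bracket (bracket i).
Proof.
split; [exact: bracket_continuous | exact: bracket_shift | exact: bracket_lie].
Qed.

(** The sequence [cross u v] inherits the period [j], so its values at [h] and [h - j] are equal and
    cancel in characteristic 2. *)
Lemma bracket_periodic_eq0 (j : nat) (u v : X) :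
    (0 < j)%N -> shift_act j%:Z u = u -> shift_act j%:Z v = v ->
  bracket j u v = 0.
Proof.
move=> j0 uj vj; apply/funext => h.
by rewrite bracketE gtn_eqF // -cross_shift uj vj K_addrr.
Qed.

Definition periodic_indicator (j : nat) (a : K * K * K) : X :=
  fun n => if (j%:Z %| n)%Z then a else 0.

Lemma periodic_indicatorP (j : nat) (a : K * K * K) :
  shift_act j%:Z (periodic_indicator j a) = periodic_indicator j a.
Proof.
by apply/funext => n; rewrite /shift_act /periodic_indicator rpredBr ?dvdzz.
Qed.

(** At coordinate 0 the term of index 0 is 1. For [0 < i] the other term has index [-i], not a
    multiple of [j], and vanishes. *)
Lemma bracket_periodic_indicator_neq0 (i j : nat) : (i < j)%N ->
  bracket i (periodic_indicator j (1, 0, 0)) (periodic_indicator j (0, 1, 0)) <> 0.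
Proof.
move=> ij /(congr1 (fun w : X => w 0)); rewrite bracketE => /(congr1 snd) /=.
rewrite /cross /periodic_indicator dvdz0 /= sub0r rpredN.
case: eqP => [_|/eqP i0]; first by rewrite mulr1 mul0r subr0 addr0.
by rewrite [(_ %| _)%Z]gtnNdvd ?lt0n.
Qed.

Lemma bracket_not_isomorphic (i j : nat) : (i < j)%N ->
  ~ exists phi : X -> X,
      pointed_bracket_isomorphism (bracket i) (bracket j) phi.
Proof.
move=> ij [phi [[_ [psi [phiK _ _]]] phi_shift phi0 phiB]].
(* By injectivity it suffices that [phi] sends this nonzero bracket to [phi 0]; its image is a
   [j]-th bracket of points of period [j]. *)
apply: (bracket_periodic_indicator_neq0 _ _ ij); apply: (can_inj phiK).
rewrite phiB phi0; apply: bracket_periodic_eq0; first exact: leq_ltn_trans ij.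
all: by rewrite -phi_shift periodic_indicatorP.
Qed.

Theorem mainTheorem7 :
  (forall i : nat, compatible_lie_bracket (bracket i)) /\
  (forall i j : nat, (i < j)%N ->
    (~ exists phi : X -> X,
         lie_subshift_isomorphism (bracket i) (bracket j) phi) /\
    (~ exists phi : X -> X,
         pointed_bracket_isomorphism (bracket i) (bracket j) phi)).
Proof.
split; first exact: bracket_compatible.
move=> i j ij; split; last exact: bracket_not_isomorphic.
move=> [phi [phi_homeo phi_shift phi_linear phiB]].
apply: (bracket_not_isomorphic _ _ ij); exists phi; split=> //.
(* Linearity with scalar -1 at the origin reads [phi 0 = - phi 0 + phi 0]. *)
by have := phi_linear (-1) 0 0; rewrite scaler0 addr0 scaleN1r addNr.
Qed.
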